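(* Let $\Sigma$ be an orientable, complete, non-compact surface embedded in $\mathbb{R}^3$, not totally geodesic, whose second fundamental form goes to zero at infinity, and let $\Omega=\Sigma\times[-a,a]$ be the quantum layer over $\Sigma$, where $a>0$ is such that $\tilde p(x,t)=p(x)+t\vec N_x$ is an embedding of $\Sigma\times[-a,a]$ into $\mathbb{R}^3$. For any $0<\varepsilon<1$, there is a compact set $K$ of $\Sigma$ such that on $\Sigma\setminus K$ (for all $t\in[-a,a]$ and in any local coordinates $(x_1,x_2)$ of $\Sigma$) we have, as inequalities between symmetric matrices, $$(1-\varepsilon)\begin{pmatrix}g_{11}&g_{12}\\ g_{21}&g_{22}\end{pmatrix}\le\begin{pmatrix}G_{11}&G_{12}\\ G_{21}&G_{22}\end{pmatrix}\le(1+\varepsilon)\begin{pmatrix}g_{11}&g_{12}\\ g_{21}&g_{22}\end{pmatrix}.$$ In particular, over $\Sigma\setminus K$ we have $$(1-\varepsilon)^2\,d\Sigma\,dt\le d\Omega\le(1+\varepsilon)^2\,d\Sigma\,dt.$$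
   Context: All surfaces are smooth. Let $p:\Sigma\to\mathbb{R}^3$ be the embedding and $\vec N$ a unit normal vector field of $\Sigma$. The second fundamental form $B$ goes to zero at infinity if for every $\varepsilon>0$ there is a compact subset of $\Sigma$ outside of which $\|B\|<\varepsilon$. The quantum layer is $\Omega=\Sigma\times[-a,a]$ with the Riemannian metric $ds^2_\Omega$ obtained by pulling back the Euclidean metric via $\tilde p$. If $(x_1,x_2)$ are local coordinates on $\Sigma$, then $(x_1,x_2,x_3)$ with $x_3=t$ are local (Fermi) coordinates on $\Omega$. Write $ds^2_\Sigma=\sum_{i,j\le 2} g_{ij}\,dx_i\,dx_j$ for the induced metric of $\Sigma$ and $ds^2_\Omega=\sum_{i,j\le 3} G_{ij}\,dx_i\,dx_j$; thus $G_{ij}=\langle (p+t\vec N)_{x_i},(p+t\vec N)_{x_j}\rangle$ for $1\le i,j\le2$, $G_{i3}=G_{3i}=0$ for $i\ne3$, and $G_{33}=1$. $d\Sigma$ and $d\Omega$ denote the Riemannian volume measures of $\Sigma$ and $\Omega$. For symmetric matrices, $A\le A'$ means that $A'-A$ is positive semidefinite. *)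

(* Defs.v *)
From HB Require Import structures.
From mathcomp Require Import all_boot all_order all_algebra.
From mathcomp Require Import all_classical all_reals all_analysis.

Set Implicit Arguments.
Unset Strict Implicit.
Unset Printing Implicit Defensive.

Import Order.TTheory GRing.Theory Num.Theory.
Import numFieldNormedType.Exports.

Local Open Scope classical_set_scope.
Local Open Scope ring_scope.

Section Calculus.
Context {R : realType}.

Definition dot n (u v : 'rV[R]_n) : R := \sum_i u 0 i * v 0 i.

(* The library norm on ['rV[R]_n] is the sup norm, hence this one. *)
Definition enorm n (u : 'rV[R]_n) : R := Num.sqrt (dot u u).

Definition psd n (A : 'M[R]_n) : Prop :=
  A^T = A /\ forall v : 'rV[R]_n, 0 <= dot (v *m A) v.

Definition psd_le n (A B : 'M[R]_n) : Prop := psd (B - A).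

(* Meant for [U] open and [V] finite-dimensional, where existence and
   continuity on [U] of all iterated directional derivatives up to order [k]
   is the usual class C^k. *)
Fixpoint Ck (V W : normedModType R) (k : nat) (U : set V) (f : V -> W) : Prop :=
  (forall x, U x -> {for x, continuous f}) /\
  if k is k'.+1 then
    (forall x v, U x -> derivable f x v) /\
    (forall v, Ck k' U (fun x => derive f x v))
  else True.

Definition smooth (V W : normedModType R) (U : set V) (f : V -> W) : Prop :=
  forall k, Ck k U f.

Definition e2 (i : 'I_2) : R * R := if i == 0 then (1, 0) else (0, 1).

Definition e3 (i : 'I_3) : R * R * R :=
  if i == ord_max then ((0, 0), 1) else (e2 (inord i), 0).

Definition partial2 (f : R * R -> 'rV[R]_3) (i : 'I_2) (u : R * R) : 'rV[R]_3 :=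
  derive f u (e2 i).

Definition partial3 (f : R * R * R -> 'rV[R]_3) (i : 'I_3) (q : R * R * R) :
  'rV[R]_3 := derive f q (e3 i).

(* Rows are the coordinate vectors: these are transposed Jacobian matrices. *)
Definition jac2 (f : R * R -> 'rV[R]_3) (u : R * R) : 'M[R]_(2, 3) :=
  \matrix_(i < 2) partial2 f i u.

Definition jac3 (f : R * R * R -> 'rV[R]_3) (q : R * R * R) : 'M[R]_3 :=
  \matrix_(i < 3) partial3 f i q.

(* Euclidean metric pulled back by [f], in the standard coordinates. *)
Definition pullback2 (f : R * R -> 'rV[R]_3) (u : R * R) : 'M[R]_2 :=
  \matrix_(i, j) dot (partial2 f i u) (partial2 f j u).

Definition pullback3 (f : R * R * R -> 'rV[R]_3) (q : R * R * R) : 'M[R]_3 :=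
  \matrix_(i, j) dot (partial3 f i q) (partial3 f j q).

End Calculus.

Section Surfaces.
Context {R : realType}.
Local Notation E3 := 'rV[R]_3.
Implicit Types (S : set E3) (N : E3 -> E3) (U : set (R * R)) (phi : R * R -> E3).

(* An embedded surface is identified with its image [S] in R^3, so the embedding
   [p] is the inclusion and local coordinates are inverses of smooth
   parametrizations [phi] of relatively open subsets of [S]. *)
Definition local_param S U phi : Prop :=
  [/\ open U, smooth U phi, set_inj U phi,
      forall u, U u -> row_free (jac2 phi u) &
      forall W, open W -> W `<=` U ->
        exists2 O : set E3, open O & phi @` W = S `&` O].

Definition embedded_surface S : Prop :=
  forall x, S x -> exists U phi, local_param S U phi /\ (phi @` U) x.

(* [M] is the (transposed) Jacobian matrix of the change of coordinates. *)
Definition orientable S : Prop :=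
  exists atlas : set (set (R * R) * (R * R -> E3)),
  [/\ forall c, atlas c -> local_param S c.1 c.2,
      forall x, S x -> exists2 c, atlas c & (c.2 @` c.1) x &
      forall c d u v, atlas c -> atlas d -> c.1 u -> d.1 v -> c.2 u = d.2 v ->
        exists2 M : 'M[R]_2, 0 < \det M & jac2 d.2 v = M *m jac2 c.2 u].

Definition arc_length (gamma : R -> E3) : \bar R :=
  (\int[lebesgue_measure]_(t in `[0%R, 1%R]) (enorm (derive1 gamma t))%:E)%E.

(* [path_in S x y l]: [x] and [y] are joined in [S] by a piecewise C^1 curve of
   length [l]. *)
Inductive path_in S : E3 -> E3 -> \bar R -> Prop :=
| path_in_nil x : S x -> path_in S x x 0%E
| path_in_cons (gamma : R -> E3) y l :
    Ck 1 setT gamma -> (forall t, 0 <= t <= 1 -> S (gamma t)) ->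
    path_in S (gamma 1) y l ->
    path_in S (gamma 0) y (arc_length gamma + l)%E.

(* Riemannian distance; it is [+oo] between distinct connected components. *)
Definition rdist S (x y : E3) : \bar R := ereal_inf [set l | path_in S x y l].

Definition complete_surface S : Prop :=
  forall x_ : nat -> E3, (forall n, S (x_ n)) ->
    (forall e : R, 0 < e -> exists n0, forall m n, (n0 <= m)%N -> (n0 <= n)%N ->
       (rdist S (x_ m) (x_ n) < e%:E)%E) ->
    exists2 x, S x &
      forall e : R, 0 < e -> exists n0, forall n, (n0 <= n)%N ->
        (rdist S (x_ n) x < e%:E)%E.

Definition unit_normal S N : Prop :=
  [/\ forall x, S x -> dot (N x) (N x) = 1,
      forall U phi, local_param S U phi -> smooth U (N \o phi) &
      forall U phi u i, local_param S U phi -> U u ->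
        dot (partial2 phi i u) (N (phi u)) = 0].

(* First and second fundamental forms in the coordinates given by [phi]. *)
Definition fff phi (u : R * R) : 'M[R]_2 := pullback2 phi u.

Definition sff N phi (u : R * R) : 'M[R]_2 :=
  \matrix_(i, j) dot (partial2 (partial2 phi j) i u) (N (phi u)).

(* Norm of [B] as a tensor: |B|^2 = sum g^{ij} g^{kl} b_{jk} b_{li}, which does
   not depend on the coordinates. *)
Definition sff_norm N phi (u : R * R) : R :=
  let A := invmx (fff phi u) *m sff N phi u in Num.sqrt (\tr (A *m A)).

Definition totally_geodesic S N : Prop :=
  forall U phi u, local_param S U phi -> U u -> sff N phi u = 0.

Definition sff_vanishes_at_infinity S N : Prop :=
  forall e : R, 0 < e -> exists K : set E3,
    [/\ compact K, K `<=` S &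
        forall U phi u, local_param S U phi -> U u -> ~ K (phi u) ->
          sff_norm N phi u < e].

Definition layer S (a : R) : set (E3 * R) := S `*` `[- a, a].

Definition layer_map N (q : E3 * R) : E3 := q.1 + q.2 *: N q.1.

(* [layer_map N] in the Fermi coordinates [(x1, x2, t)] attached to [phi]; it is
   also defined for [t] outside [[-a, a]], so derivatives at [t = -a] and
   [t = a] need no one-sided version. *)
Definition fermi N phi (q : R * R * R) : E3 := layer_map N (phi q.1, q.2).

Definition layer_embedding S N (a : R) : Prop :=
  [/\ set_inj (layer S a) (layer_map N),
      forall U phi u t, local_param S U phi -> U u -> - a <= t <= a ->
        row_free (jac3 (fermi N phi) (u, t)) &
      forall W : set (E3 * R), open W ->
        exists2 O : set E3, open O &
          layer_map N @` (layer S a `&` W) = (layer_map N @` layer S a) `&` O].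

Definition layer_metric N phi (q : R * R * R) : 'M[R]_3 :=
  pullback3 (fermi N phi) q.

(* The block (G_{ij}) with i, j <= 2. *)
Definition layer_metric2 N phi (q : R * R * R) : 'M[R]_2 :=
  \matrix_(i, j) layer_metric N phi q (inord i) (inord j).

End Surfaces.

Section Volume.
Context (R : realType).

Definition borel3 : Type := g_sigma_algebraType (@open 'rV[R]_3).
HB.instance Definition _ := Measurable.on borel3.

Local Notation mR := (measurableTypeR R).

Definition leb2 : {measure set (mR * mR) -> \bar R} :=
  (@lebesgue_measure R \x @lebesgue_measure R)%E.

Definition leb3 : {measure set (mR * mR * mR) -> \bar R} :=
  (leb2 \x @lebesgue_measure R)%E.

(* The Riemannian measure of [S], as a Borel measure of R^3 carried by [S]: it
   has density sqrt (det g) in all local coordinates. *)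
Definition surface_measure (S : set 'rV[R]_3)
    (mu : {measure set borel3 -> \bar R}) : Prop :=
  mu (~` S) = 0%E /\
  forall (U : set (R * R)) (phi : R * R -> 'rV[R]_3) (A : set borel3),
    local_param S U phi -> measurable A -> A `<=` phi @` U ->
    mu A = (\int[leb2]_(u in U `&` phi @^-1` A)
              (Num.sqrt (\det (fff phi u)))%:E)%E.

(* The Riemannian measure of the layer, as a Borel measure of R^3 x R carried by
   the layer: it has density sqrt (det G) in all Fermi coordinates. *)
Definition layer_measure (S : set 'rV[R]_3) (N : 'rV[R]_3 -> 'rV[R]_3) (a : R)
    (mu : {measure set (borel3 * mR) -> \bar R}) : Prop :=
  mu (~` layer S a) = 0%E /\
  forall (U : set (R * R)) (phi : R * R -> 'rV[R]_3)
      (A : set (borel3 * mR)),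
    local_param S U phi -> measurable A -> A `<=` (phi @` U) `*` `[- a, a] ->
    mu A = (\int[leb3]_(q in [set q : R * R * R | U q.1 /\ A (phi q.1, q.2)])
              (Num.sqrt (\det (layer_metric N phi q)))%:E)%E.

End Volume.

(* Main.v *)
(* Write [g] for the first fundamental form, [X_i = d_i phi] and
   [Y_i = d_i (N o phi)].  In Fermi coordinates [G_ij = <X_i + t Y_i, X_j + t Y_j>],
   so for a tangent vector [V = sum v_i X_i] with image [W = sum v_i Y_i] under the
   differential of [N], [G(v, v) = |V|^2 + 2 t <V, W> + t^2 |W|^2].  Since [W] is
   tangent and [<Y_i, X_j> = - b_ij], [|W| <= |B| |V|]; symmetry of [b] (equality of
   mixed partial derivatives) is needed here, because [|B|^2] is the trace of
   [(g^-1 b)^2].  With [a |B| <= eps / 3] off a compact set the matrix inequalities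
   follow, and taking determinants gives the inequality between the densities
   [sqrt (det g)] and [sqrt (det G)].  The measures are compared chart by chart,
   on countably many disjoint Borel pieces of the layer: in a chart, Tonelli's
   theorem turns the product of the surface measure and of Lebesgue measure into
   the integral of [sqrt (det g)] over the Fermi coordinate domain. *)
Require Import Defs.
From HB Require Import structures.
From mathcomp Require Import all_boot all_order all_algebra.
From mathcomp Require Import all_classical all_reals all_analysis.
From mathcomp Require Import measurable_realfun ring lra.

Set Implicit Arguments.
Unset Strict Implicit.
Unset Printing Implicit Defensive.

Import Order.TTheory GRing.Theory Num.Theory.
Import numFieldNormedType.Exports.

Local Open Scope classical_set_scope.
Local Open Scope ring_scope.

(** * Quadratic forms and Gram matrices *)

Lemma ord2P (i : 'I_2) : i = 0 \/ i = 1.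
Proof. by case: i => [[|[|//]] ?]; [left|right]; apply/val_inj. Qed.

Lemma det2E (R : comPzRingType) (A : 'M[R]_2) :
  \det A = A 0 0 * A 1 1 - A 0 1 * A 1 0.
Proof.
rewrite (expand_det_row _ 0) !big_ord_recl big_ord0 addr0 /cofactor.
rewrite !det_mx11 !mxE /= expr0 expr1 mul1r mulN1r mulrN.
by congr (A _ _ * A _ _ - A _ _ * A _ _); apply/val_inj.
Qed.

Lemma dot2E (R : realType) (u v : 'rV[R]_2) :
  dot u v = u 0 0 * v 0 0 + u 0 1 * v 0 1.
Proof.
rewrite /dot !big_ord_recl big_ord0 addr0.
by have -> : lift ord0 ord0 = 1 :> 'I_2 by apply/val_inj.
Qed.

Lemma dot3E (R : realType) (u v : 'rV[R]_3) :
  dot u v = u 0 0 * v 0 0 + u 0 1 * v 0 1 + u 0 2 * v 0 2.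
Proof.
rewrite /dot !big_ord_recl big_ord0 addr0 addrA.
have -> : lift ord0 (lift ord0 ord0) = 2 :> 'I_3 by apply/val_inj.
by have -> : lift ord0 ord0 = 1 :> 'I_3 by apply/val_inj.
Qed.

Lemma dotC (R : realType) n (u v : 'rV[R]_n) : dot u v = dot v u.
Proof. by apply: eq_bigr => i _; rewrite mulrC. Qed.

Lemma quad2E (R : realType) (A : 'M[R]_2) (v : 'rV[R]_2) :
  dot (v *m A) v = v 0 0 ^+ 2 * A 0 0 + v 0 0 * v 0 1 * (A 0 1 + A 1 0)
                   + v 0 1 ^+ 2 * A 1 1.
Proof.
rewrite dot2E !mxE !big_ord_recl !big_ord0.
have -> : lift 0 0 = 1 :> 'I_2 by apply/val_inj.
by ring.
Qed.

Lemma psd2P (R : realType) (A : 'M[R]_2) : psd A <->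
  A 0 1 = A 1 0 /\
  forall x y, 0 <= x ^+ 2 * A 0 0 + x * y * (A 0 1 + A 1 0) + y ^+ 2 * A 1 1.
Proof.
split=> [[AT A0]|[AT A0]]; split.
- by rewrite -{1}AT mxE.
- move=> x y; have := A0 (\row_j if j == 0 then x else y).
  by rewrite quad2E !mxE.
- apply/matrixP => i j; rewrite mxE.
  by case: (ord2P i) => ->; case: (ord2P j) => ->.
- by move=> v; rewrite quad2E; exact: A0.
Qed.

Lemma det_psd2_le (R : realType) (A B : 'M[R]_2) :
  psd A -> psd_le A B -> \det A <= \det B.
Proof.
move=> /psd2P[As A0] /psd2P; rewrite !mxE => -[Ms M0].
set p := A 0 0 in A0 M0 *; set q := A 0 1 in As A0 M0 Ms *.
set r := A 1 1 in A0 M0 *.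
pose x := B 0 0 - p; pose y := B 0 1 - q; pose z := B 1 1 - r.
have Bs : B 1 0 = B 0 1 by rewrite -As in Ms; lra.
have {}M0 s t : 0 <= s ^+ 2 * x + 2 * s * t * y + t ^+ 2 * z.
  by have := M0 s t; rewrite -As Bs -/x -/y -/z; congr (_ <= _); rewrite /y; ring.
have {}A0 s t : 0 <= s ^+ 2 * p + 2 * s * t * q + t ^+ 2 * r.
  by have := A0 s t; rewrite -As; congr (_ <= _); ring.
rewrite !det2E Bs -As -/p -/q -/r.
have -> : B 0 0 = p + x by rewrite /x; ring.
have -> : B 0 1 = q + y by rewrite /y; ring.
have -> : B 1 1 = r + z by rewrite /z; ring.
have x0 : 0 <= x by have := M0 1 0; lra.
have z0 : 0 <= z by have := M0 0 1; lra.
have p0 : 0 <= p by have := A0 1 0; lra.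
have r0 : 0 <= r by have := A0 0 1; lra.
have det0 (s t w : R) : 0 <= s -> 0 <= w ->
    (forall a b, 0 <= a ^+ 2 * s + 2 * a * b * t + b ^+ 2 * w) -> t ^+ 2 <= s * w.
  rewrite le_eqVlt => /orP[/eqP <- w0 H|s0 w0 H].
    have [->|t0] := eqVneq t 0; first by nra.
    have := H (- (w + 1) / t) 1.
    have -> : (- (w + 1) / t) ^+ 2 * 0 + 2 * (- (w + 1) / t) * 1 * t + 1 ^+ 2 * w
      = - w - 2 by field.
    by nra.
  have := H (- t) s.
  have -> : (- t) ^+ 2 * s + 2 * - t * s * t + s ^+ 2 * w = s * (s * w - t ^+ 2).
    by ring.
  by rewrite pmulr_rge0// subr_ge0.
have := det0 _ _ _ x0 z0 M0 => dM.
have := det0 _ _ _ p0 r0 A0 => dA.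
suff : 2 * q * y <= p * z + r * x by nra.
move: p0; rewrite le_eqVlt => /orP[/eqP p0|p0].
  have -> : q = 0.
    apply/eqP; rewrite -sqrf_eq0 eq_le sqr_ge0 andbT.
    by rewrite (le_trans dA)// -p0 mul0r.
  by rewrite mulr0 mul0r -p0 mul0r add0r mulr_ge0.
rewrite -(ler_pM2l p0) -subr_ge0.
apply: le_trans (M0 (- q) p) _; rewrite -subr_ge0.
have -> : p * (p * z + r * x) - p * (2 * q * y) -
  ((- q) ^+ 2 * x + 2 * - q * p * y + p ^+ 2 * z) = (p * r - q ^+ 2) * x by ring.
by rewrite mulr_ge0// subr_ge0.
Qed.

(* In the orthogonal basis with coordinates [w = x + (F / E) y] and [y] this is
   Cauchy-Schwarz for the Hilbert-Schmidt norm; the two squares below are its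
   defect. *)
Lemma weingarten_quad_le (R : realType) (E F G l m n x y : R) :
  0 < E -> 0 < E * G - F ^+ 2 ->
  (G * (l * x + m * y) ^+ 2 - 2 * F * (l * x + m * y) * (m * x + n * y)
     + E * (m * x + n * y) ^+ 2) * (E * G - F ^+ 2)
  <= ((G * l - F * m) ^+ 2 + 2 * (G * m - F * n) * (E * m - F * l)
      + (E * n - F * m) ^+ 2) * (E * x ^+ 2 + 2 * F * x * y + G * y ^+ 2).
Proof.
move=> E0 D0; rewrite -subr_ge0.
set D := E * G - F ^+ 2 in D0 *.
pose H := D / E; pose w := x + F / E * y.
pose m' := m - F / E * l; pose n' := n - 2 * (F / E) * m + (F / E) ^+ 2 * l.
have H0 : 0 < H by rewrite divr_gt0.
have En0 : E != 0 by rewrite gt_eqF.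
rewrite (_ : _ - _ = H * (l * H * y - m' * E * w) ^+ 2
                   + E * (m' * H * y - n' * E * w) ^+ 2); last first.
  by rewrite /H /w /m' /n' /D; field.
by rewrite addr_ge0// mulr_ge0 ?sqr_ge0// ltW.
Qed.

Definition gram (R : realType) (X : 'I_2 -> 'rV[R]_3) : 'M[R]_2 :=
  \matrix_(i, j) dot (X i) (X j).

Lemma dot_gt0 (R : realType) n (u : 'rV[R]_n) : u != 0 -> 0 < dot u u.
Proof.
have dot0 : 0 <= dot u u by apply: sumr_ge0 => i _; exact: sqr_ge0.
move=> u0; rewrite lt_neqAle dot0 andbT eq_sym; apply: contra u0.
rewrite psumr_eq0 => [/allP z|i _]; last exact: sqr_ge0.
apply/eqP/rowP => i; rewrite mxE; apply/eqP.
by have := z i (mem_index_enum i); rewrite mulf_eq0 orbb.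
Qed.

Lemma gram_gt0 (R : realType) (X : 'I_2 -> 'rV[R]_3) :
  row_free (\matrix_i X i) ->
  0 < dot (X 0) (X 0) /\ 0 < dot (X 0) (X 0) * dot (X 1) (X 1) - dot (X 0) (X 1) ^+ 2.
Proof.
move=> rfX.
have pos (x y : R) : (x, y) != (0, 0) ->
    0 < x ^+ 2 * dot (X 0) (X 0) + 2 * x * y * dot (X 0) (X 1) + y ^+ 2 * dot (X 1) (X 1).
  move=> xy0; set v : 'rV[R]_2 := \row_j if j == 0 then x else y.
  have v0 : v != 0.
    apply: contra xy0 => /eqP/rowP v0.
    by have := v0 0; have := v0 1; rewrite !mxE /= => -> ->.
  have : 0 < dot (v *m \matrix_i X i) (v *m \matrix_i X i).
    apply: dot_gt0; apply: contra v0 => /eqP vX0; apply/eqP.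
    by apply: (row_free_inj rfX); rewrite vX0 mul0mx.
  rewrite !dot3E !mxE !big_ord_recl !big_ord0 !mxE /=.
  have -> : lift ord0 ord0 = 1 :> 'I_2 by apply/val_inj.
  by congr (_ < _); ring.
have E0 : 0 < dot (X 0) (X 0).
  have /pos : (1 : R, 0 : R) != (0, 0) by rewrite xpair_eqE oner_eq0.
  by rewrite expr0n /= !mulr0 !mul0r !addr0 expr1n mul1r.
split=> //; set E := dot (X 0) (X 0) in E0 pos *.
have /pos : (- dot (X 0) (X 1), E) != (0, 0) by rewrite xpair_eqE (gt_eqF E0) andbF.
move=> D0; rewrite -(pmulr_rgt0 _ E0); move: D0; congr (_ < _); ring.
Qed.

Lemma tr_shape2E (R : realType) (g b : 'M[R]_2) :
  g 0 1 = g 1 0 -> b 0 1 = b 1 0 -> \det g != 0 ->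
  \tr (invmx g *m b *m (invmx g *m b)) =
  ((g 1 1 * b 0 0 - g 0 1 * b 0 1) ^+ 2
   + 2 * (g 1 1 * b 0 1 - g 0 1 * b 1 1) * (g 0 0 * b 0 1 - g 0 1 * b 0 0)
   + (g 0 0 * b 1 1 - g 0 1 * b 0 1) ^+ 2) / (\det g) ^+ 2.
Proof.
move=> gs bs d0; set d := \det g in d0 *.
pose h : 'M[R]_2 := \matrix_(i, j) ((if (i == 0) && (j == 0) then g 1 1
  else if (i == 1) && (j == 1) then g 0 0 else - g 0 1) / d).
have -> : invmx g = h.
  have hg : h *m g = 1%:M.
    apply/matrixP => i j; rewrite !mxE !big_ord_recl big_ord0 !mxE.
    have -> : lift ord0 ord0 = 1 :> 'I_2 by apply/val_inj.
    have dE := det2E g; rewrite -/d -gs in dE.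
    by case: (ord2P i) => ->; case: (ord2P j) => -> /=;
      rewrite -?gs dE; field; rewrite -dE.
  by rewrite -[LHS]mul1mx -hg mulmxK// unitmxE unitfE.
rewrite /mxtrace !big_ord_recl big_ord0 !mxE !big_ord_recl !big_ord0 !mxE.
rewrite !big_ord_recl !big_ord0 !mxE /=.
have -> : lift ord0 ord0 = 1 :> 'I_2 by apply/val_inj.
by rewrite /= -bs; field.
Qed.

(* A triple orthogonal to [n] is dependent, so its Gram determinant vanishes. *)
Lemma gram3_eq0 (R : realType) (u v w n : 'rV[R]_3) :
  dot n n = 1 -> dot u n = 0 -> dot v n = 0 -> dot w n = 0 ->
  dot w w * (dot u u * dot v v - dot u v ^+ 2) =
  dot v v * dot w u ^+ 2 - 2 * dot u v * dot w u * dot w v + dot u u * dot w v ^+ 2.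
Proof.
rewrite !dot3E.
set u0 := u 0 0; set u1 := u 0 1; set u2 := u 0 2.
set v0 := v 0 0; set v1 := v 0 1; set v2 := v 0 2.
set w0 := w 0 0; set w1 := w 0 1; set w2 := w 0 2.
set n0 := n 0 0; set n1 := n 0 1; set n2 := n 0 2 => nn un vn wn.
pose d := u0 * (v1 * w2 - v2 * w1) - u1 * (v0 * w2 - v2 * w0)
          + u2 * (v0 * w1 - v1 * w0).
suff d0 : d = 0 by apply/eqP; rewrite -subr_eq0; apply/eqP; transitivity (d ^+ 2);
  [rewrite /d; ring|rewrite d0 expr0n].
have -> : d = d * (n0 * n0 + n1 * n1 + n2 * n2) by rewrite nn mulr1.
transitivity
 ((u0 * n0 + u1 * n1 + u2 * n2) * (n0 * (v1 * w2 - v2 * w1)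
     - n1 * (v0 * w2 - v2 * w0) + n2 * (v0 * w1 - v1 * w0))
 + (v0 * n0 + v1 * n1 + v2 * n2) * (- n0 * (u1 * w2 - u2 * w1)
     + n1 * (u0 * w2 - u2 * w0) - n2 * (u0 * w1 - u1 * w0))
 + (w0 * n0 + w1 * n1 + w2 * n2) * (n0 * (u1 * v2 - u2 * v1)
     - n1 * (u0 * v2 - u2 * v0) + n2 * (u0 * v1 - u1 * v0))).
  by rewrite /d; ring.
by rewrite un vn wn !mul0r !addr0.
Qed.

Lemma dot_lin2 (R : realType) n (u v w : 'rV[R]_n) (x y : R) :
  dot (x *: u + y *: v) w = x * dot u w + y * dot v w.
Proof.
rewrite /dot !mulr_sumr -big_split; apply: eq_bigr => i _ /=.
by rewrite !mxE mulrDl !mulrA.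
Qed.

Lemma shape_operator_le (R : realType) (X Y : 'I_2 -> 'rV[R]_3) (n : 'rV[R]_3)
    (b : 'M[R]_2) (x y : R) :
  row_free (\matrix_i X i) -> dot n n = 1 ->
  (forall i, dot (X i) n = 0) -> (forall i, dot (Y i) n = 0) ->
  (forall i j, dot (Y i) (X j) = - b i j) -> b 0 1 = b 1 0 ->
  dot (x *: Y 0 + y *: Y 1) (x *: Y 0 + y *: Y 1) <=
  \tr (invmx (gram X) *m b *m (invmx (gram X) *m b)) *
  dot (x *: X 0 + y *: X 1) (x *: X 0 + y *: X 1).
Proof.
move=> /gram_gt0[E0 D0] nn Xn Yn YX bs.
have detE : \det (gram X) = dot (X 0) (X 0) * dot (X 1) (X 1) - dot (X 0) (X 1) ^+ 2.
  by rewrite det2E !mxE (dotC (X 1) (X 0)) expr2.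
rewrite tr_shape2E//; last 2 first.
- by rewrite !mxE dotC.
- by rewrite detE gt_eqF.
rewrite detE mulrAC ler_pdivlMr ?exprn_gt0// [X in _ * X]expr2 mulrA.
have Wn : dot (x *: Y 0 + y *: Y 1) n = 0 by rewrite dot_lin2 !Yn !mulr0 addr0.
have := @gram3_eq0 _ (X 0) (X 1) (x *: Y 0 + y *: Y 1) n nn (Xn 0) (Xn 1) Wn.
move=> ->; rewrite (dot_lin2 (Y 0)) (dot_lin2 (Y 0)) !YX -bs.
have -> : dot (x *: X 0 + y *: X 1) (x *: X 0 + y *: X 1) =
   dot (X 0) (X 0) * x ^+ 2 + 2 * dot (X 0) (X 1) * x * y + dot (X 1) (X 1) * y ^+ 2.
  rewrite dot_lin2 (dotC (X 0)) (dotC (X 1)) !dot_lin2 (dotC (X 1) (X 0)).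
  by ring.
have := weingarten_quad_le (G := dot (X 1) (X 1)) (F := dot (X 0) (X 1))
  (b 0 0) (b 0 1) (b 1 1) x y E0 D0.
rewrite !mxE; apply: le_trans.
by rewrite le_eqVlt; apply/orP; left; apply/eqP; ring.
Qed.

Lemma gram_pinch (R : realType) (X Y : 'I_2 -> 'rV[R]_3) (d t eps : R) :
  0 < eps < 1 -> `|t| * d <= eps / 3 -> 0 <= d ->
  (forall x y, dot (x *: Y 0 + y *: Y 1) (x *: Y 0 + y *: Y 1) <=
     d ^+ 2 * dot (x *: X 0 + y *: X 1) (x *: X 0 + y *: X 1)) ->
  psd_le ((1 - eps) *: gram X) (gram (fun i => X i + t *: Y i)) /\
  psd_le (gram (fun i => X i + t *: Y i)) ((1 + eps) *: gram X).
Proof.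
move=> /andP[e0 e1] td d0 YX.
have key x y : let V := x *: X 0 + y *: X 1 in let W := x *: Y 0 + y *: Y 1 in
    `|2 * t * dot V W + t ^+ 2 * dot W W| <= eps * dot V V.
  move=> V W; have WV := YX x y; rewrite -/V -/W in WV.
  have P0 : 0 <= dot V V by apply: sumr_ge0 => i _; exact: sqr_ge0.
  have S0 : 0 <= dot W W by apply: sumr_ge0 => i _; exact: sqr_ge0.
  have CS : dot V W ^+ 2 <= dot V V * dot W W.
    rewrite -subr_ge0 !dot3E.
    set a0 := V 0 0; set a1 := V 0 1; set a2 := V 0 2.
    set b0 := W 0 0; set b1 := W 0 1; set b2 := W 0 2.
    rewrite (_ : _ - _ = (a0 * b1 - a1 * b0) ^+ 2 + (a0 * b2 - a2 * b0) ^+ 2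
      + (a1 * b2 - a2 * b1) ^+ 2); last by ring.
    by rewrite !addr_ge0 ?sqr_ge0.
  have e30 : 0 <= eps / 3 by rewrite divr_ge0// ltW.
  have td2 : t ^+ 2 * d ^+ 2 <= (eps / 3) ^+ 2.
    rewrite -[t ^+ 2]real_normK ?num_real// -exprMn.
    by rewrite ler_sqr ?nnegrE// mulr_ge0.
  have tS : t ^+ 2 * dot W W <= (eps / 3) ^+ 2 * dot V V.
    apply: (@le_trans _ _ (t ^+ 2 * (d ^+ 2 * dot V V))).
      by rewrite ler_wpM2l ?sqr_ge0.
    by rewrite mulrA ler_wpM2r.
  have tQ : `|t * dot V W| <= eps / 3 * dot V V.
    have eP : 0 <= eps / 3 * dot V V by rewrite mulr_ge0.
    rewrite -ler_sqr ?nnegrE// real_normK ?num_real//.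
    rewrite exprMn [X in _ <= X]exprMn.
    apply: (@le_trans _ _ (t ^+ 2 * (dot V V * dot W W))).
      by rewrite ler_wpM2l ?sqr_ge0.
    by rewrite mulrCA [X in _ <= X * _]mulrC [X in _ <= _ * X]expr2; nra.
  have e9 : (eps / 3) ^+ 2 <= eps / 3 by nra.
  rewrite -mulrA; apply: (le_trans (ler_normD _ _)).
  have tS0 : 0 <= t ^+ 2 * dot W W by rewrite mulr_ge0// sqr_ge0.
  by rewrite normrM normr_nat (ger0_norm tS0); nra.
have GE i j : gram (fun i => X i + t *: Y i) i j = dot (X i) (X j)
    + t * dot (X i) (Y j) + t * dot (Y i) (X j) + t ^+ 2 * dot (Y i) (Y j).
  by rewrite mxE !dot3E !mxE; ring.
split; apply/psd2P; rewrite !mxE; split.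
- by rewrite (dotC (X 1)) (dotC (X 1 + _)).
- move=> x y; have := key x y => /=; rewrite ler_norml => /andP[+ _].
  rewrite -subr_ge0; congr (_ <= _).
  by rewrite !dot3E !mxE; ring.
- by rewrite (dotC (X 1)) (dotC (X 1 + _)).
- move=> x y; have := key x y => /=; rewrite ler_norml => /andP[_].
  rewrite -subr_ge0; congr (_ <= _).
  by rewrite !dot3E !mxE; ring.
Qed.

(** * Directional derivatives *)

Lemma is_derive_coord (R : realType) (V : normedModType R) n (f : V -> 'rV[R]_n)
    (x v : V) (i : 'I_n) :
  derivable f x v -> is_derive x v (fun y => f y 0 i) ('D_v f x 0 i).
Proof.
move=> df; have dfi := (derivable_mxP _ _ _).1 df 0 i.
by apply: DeriveDef => //; rewrite derive_mx// mxE.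
Qed.

Lemma is_derive_dot (R : realType) (V : normedModType R) (f g : V -> 'rV[R]_3)
    (x v : V) :
  derivable f x v -> derivable g x v ->
  is_derive x v (fun y => dot (f y) (g y)) (dot ('D_v f x) (g x) + dot (f x) ('D_v g x)).
Proof.
move=> df dg.
have dM i := is_deriveM (is_derive_coord i df) (is_derive_coord i dg).
have -> : (fun y => dot (f y) (g y)) =
    ((fun y => f y 0 0) * (fun y => g y 0 0)) + ((fun y => f y 0 1) * (fun y => g y 0 1))
    + ((fun y => f y 0 2) * (fun y => g y 0 2)).
  by apply/funext => y; rewrite dot3E.
apply: is_derive_eq; rewrite !dot3E.
by rewrite /GRing.scale /=; ring.
Qed.

Lemma derive_dot_cst (R : realType) (V : normedModType R) (f g : V -> 'rV[R]_3)
    (U : set V) (c : R) (x v : V) :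
  open U -> U x -> (forall y, U y -> dot (f y) (g y) = c) ->
  derivable f x v -> derivable g x v ->
  dot ('D_v f x) (g x) + dot (f x) ('D_v g x) = 0.
Proof.
move=> oU Ux fgc df dg; have [_ <-] := is_derive_dot df dg.
rewrite -(derive_cst c x v); apply: near_eq_derive.
by near=> y; apply: fgc; near: y; exact: open_nbhs_nbhs.
Unshelve. all: by end_near. Qed.

Lemma MVT_direction (R : realType) (V : normedModType R) (f df : V -> R)
    (x v : V) (h : R) :
  0 < h -> (forall s, 0 <= s <= h -> is_derive (x + s *: v) v f (df (x + s *: v))) ->
  exists2 s, 0 <= s <= h & f (x + h *: v) - f x = h * df (x + s *: v).
Proof.
move=> h0 dfv; pose g s := f (x + s *: v).
have dg s : 0 <= s <= h -> is_derive s 1 g (df (x + s *: v)).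
  move=> /dfv[+ <-]; rewrite /derivable /derive.
  set k := (fun t : R => _) => kv.
  have kE : k = fun t : R => t^-1 *: (g (t *: 1 + s) - g s).
    apply/funext => t; rewrite /k /g /=; congr (_ *: (f _ - _)).
    by rewrite [t *: 1]mulr1 scalerDl addrCA.
  by rewrite kE in kv *; exact: DeriveDef.
have [||s] := @MVT R g (fun s => df (x + s *: v)) 0 h h0.
- by move=> s /[!in_itv]/= /andP[s0 sh]; apply: dg; rewrite !ltW.
- apply: derivable_within_continuous => s /[!in_itv]/= sh.
  by have [] := dg s sh.
rewrite in_itv /= => /andP[s0 sh] gh; exists s; first by rewrite !ltW.
by move: gh; rewrite /g scale0r addr0 subr0 mulrC.
Qed.

Lemma second_difference (R : realType) (V : normedModType R) (f fv fvw : V -> R)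
    (U : set V) (u v w : V) (e : R) :
  open U -> U u ->
  (forall x, U x -> is_derive x v f (fv x)) ->
  (forall x, U x -> is_derive x w fv (fvw x)) ->
  {for u, continuous fvw} -> 0 < e ->
  exists2 r, 0 < r & forall h, 0 < h < r ->
    `|f (u + h *: v + h *: w) - f (u + h *: v) - f (u + h *: w) + f u
      - h * (h * fvw u)| <= h * (h * e).
Proof.
move=> oU Uu dv dw cvw e0.
have /nbhs_ballP[d /= d0 dP] : \forall x \near u, U x /\ `|fvw u - fvw x| < e.
  near=> x; split.
    by near: x; exact: open_nbhs_nbhs.
  by near: x; move/cvgrPdist_lt : cvw; exact.
have c0 : 0 < `|v| + `|w| + 1 by rewrite ltr_wpDl// addr_ge0.
exists (d / (`|v| + `|w| + 1)); first by rewrite divr_gt0.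
move=> h /andP[h0]; rewrite ltr_pdivlMr// => hd.
have near_u s t : 0 <= s <= h -> 0 <= t <= h -> U (u + s *: v + t *: w) /\
    `|fvw u - fvw (u + s *: v + t *: w)| < e.
  move=> /andP[s0 sh] /andP[t0 th]; apply: dP.
  rewrite -ball_normE /= -addrA opprD addNKr normrN.
  apply: le_lt_trans hd; apply: (le_trans (ler_normD _ _)).
  rewrite !normrZ (ger0_norm s0) (ger0_norm t0) !mulrDr mulr1.
  by rewrite -[leLHS]addr0 lerD// ?(ltW h0)// lerD// ler_wpM2r.
have h00 : 0 <= h <= h by rewrite lexx ltW.
have z0 : 0 <= (0 : R) <= h by rewrite lexx ltW.
pose g x := f (x + h *: w) - f x; pose dg x := fv (x + h *: w) - fv x.
have [s sh gE] : exists2 s, 0 <= s <= h & g (u + h *: v) - g u = h * dg (u + s *: v).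
  apply: MVT_direction => // s sh.
  have Us : U (u + s *: v) by have [] := near_u s 0 sh z0; rewrite scale0r addr0.
  have Ush : U (u + s *: v + h *: w) by have [] := near_u s h sh h00.
  apply: is_deriveB; last exact: dv.
  have [+ <-] := dv _ Ush; rewrite /derivable /derive.
  set k := (fun t : R => _) => kv.
  have kE : k = fun t : R => t^-1 *: (f (t *: v + (u + s *: v) + h *: w)
      - f (u + s *: v + h *: w)).
    by apply/funext => t; rewrite /k /= !addrA.
  by rewrite kE in kv *; exact: DeriveDef.
have [t th dgE] : exists2 t, 0 <= t <= h &
    fv (u + s *: v + h *: w) - fv (u + s *: v) = h * fvw (u + s *: v + t *: w).
  apply: MVT_direction => // t th.
  by apply: dw; have [] := near_u s t sh th.
have -> : f (u + h *: v + h *: w) - f (u + h *: v) - f (u + h *: w) + f u =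
    g (u + h *: v) - g u by rewrite /g; ring.
rewrite gE /dg dgE -!mulrBr !normrM !(gtr0_norm h0) !ler_pM2l// distrC.
by have [_ /ltW] := near_u s t sh th.
Unshelve. all: by end_near. Qed.

Lemma mixed_derivatives_commute (R : realType) (V : normedModType R)
    (f fv fw fvw fwv : V -> R) (U : set V) (u v w : V) :
  open U -> U u ->
  (forall x, U x -> is_derive x v f (fv x)) ->
  (forall x, U x -> is_derive x w f (fw x)) ->
  (forall x, U x -> is_derive x w fv (fvw x)) ->
  (forall x, U x -> is_derive x v fw (fwv x)) ->
  {for u, continuous fvw} -> {for u, continuous fwv} -> fvw u = fwv u.
Proof.
move=> oU Uu dv dw dvw dwv cvw cwv.
apply/eqP; rewrite -subr_eq0 -normr_le0; apply/ler_addgt0Pl => e e0.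
rewrite addr0; have e20 : 0 < e / 2 by rewrite divr_gt0.
have [r r0 rP] := second_difference oU Uu dv dvw cvw e20.
have [q q0 qP] := second_difference oU Uu dw dwv cwv e20.
pose h := Num.min r q / 2.
have m0 : 0 < Num.min r q by rewrite lt_min r0.
have h0 : 0 < h by rewrite divr_gt0.
have hm : h < Num.min r q by rewrite ltr_pdivrMr// ltr_pMr// ltr1n.
have /rP : 0 < h < r by rewrite h0 (lt_le_trans hm)// ge_min lexx.
have /qP : 0 < h < q by rewrite h0 (lt_le_trans hm)// ge_min lexx orbT.
rewrite (addrAC u (h *: w)) => B A.
rewrite -(ler_pM2l h0) -(ler_pM2l h0).
have <- : `|h| = h by rewrite gtr0_norm.
rewrite -!normrM (gtr0_norm h0); set Z := f (u + h *: v + h *: w) in A B.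
have -> : h * (h * (fvw u - fwv u)) =
  (Z - f (u + h *: w) - f (u + h *: v) + f u - h * (h * fwv u)) -
  (Z - f (u + h *: v) - f (u + h *: w) + f u - h * (h * fvw u)) by ring.
apply: (le_trans (ler_normB _ _)); apply: (le_trans (lerD B A)).
by rewrite (_ : _ + _ = h * (h * e)); [exact: lexx | field].
Qed.

Lemma derive_fermi (R : realType) (N : 'rV[R]_3 -> 'rV[R]_3) (phi : R * R -> 'rV[R]_3)
    (u v : R * R) (t : R) :
  derivable phi u v -> derivable (N \o phi) u v ->
  'D_(v, 0) (fermi N phi) (u, t) = 'D_v phi u + t *: 'D_v (N \o phi) u.
Proof.
move=> dphi dN; have [_ <-] := is_deriveD (derivableP dphi) (is_deriveZ t (derivableP dN)).
rewrite /derive; set k := (fun h : R => _); set l := (fun h : R => _).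
suff -> : k = l by [].
apply/funext => h; rewrite /k /l /fermi /layer_map /=.
by rewrite [h *: 0]mulr0 add0r.
Qed.

Lemma derive_fermi_normal (R : realType) (N : 'rV[R]_3 -> 'rV[R]_3)
    (phi : R * R -> 'rV[R]_3) (u : R * R) (t : R) :
  'D_((0, 0), 1) (fermi N phi) (u, t) = N (phi u).
Proof.
rewrite /derive; apply/cvg_lim => //.
apply: cvg_near_cst; near=> h.
rewrite /fermi /layer_map /=.
have -> : (h *: (0, 0) + u : R * R) = u.
  have h0 (x : R) : h * 0 + x = x by rewrite mulr0 add0r.
  by case: u => x y; exact: (congr2 pair (h0 x) (h0 y)).
rewrite [h *: 1]mulr1 opprD addrACA subrr add0r -scalerBl addrK scalerA.
rewrite mulVf ?scale1r//; near: h; exact: nbhs_dnbhs_neq.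
Unshelve. all: by end_near. Qed.

(** * Geometry of the layer *)

Lemma smooth_derivable (R : realType) (V W : normedModType R) (U : set V) (f : V -> W)
    (x v : V) : smooth U f -> U x -> derivable f x v.
Proof. by move=> /(_ 1)[_ [df _]]; exact: df. Qed.

Lemma smooth_derive (R : realType) (V W : normedModType R) (U : set V) (f : V -> W)
    (v : V) : smooth U f -> smooth U (fun x => 'D_v f x).
Proof. by move=> sf k; have [_ [_]] := sf k.+1; exact. Qed.

Lemma smooth_continuous (R : realType) (V W : normedModType R) (U : set V) (f : V -> W)
    (x : V) : smooth U f -> U x -> {for x, continuous f}.
Proof. by move=> /(_ 0)[cf _]; exact: cf. Qed.

Lemma smooth_mixed_derivatives (R : realType) (V : normedModType R) n (U : set V)
    (f : V -> 'rV[R]_n) (u v w : V) : open U -> smooth U f -> U u ->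
  'D_w (fun x => 'D_v f x) u = 'D_v (fun x => 'D_w f x) u.
Proof.
move=> oU sf Uu; apply/rowP => k.
have D1 z x : U x -> is_derive x z (fun y => f y 0 k) ('D_z f x 0 k).
  by move=> Ux; apply: is_derive_coord; exact: smooth_derivable sf Ux.
have D2 z z' x : U x ->
    is_derive x z (fun y => 'D_z' f y 0 k) ('D_z (fun y => 'D_z' f y) x 0 k).
  by move=> Ux; apply: is_derive_coord; exact: smooth_derivable (smooth_derive z' sf) Ux.
have cD z z' : {for u, continuous (fun x => 'D_z (fun y => 'D_z' f y) x 0 k)}.
  apply: (@continuous_comp _ _ _ (fun x => 'D_z (fun y => 'D_z' f y) x)
    (fun M : 'rV[R]_n => M 0 k)); last exact: coord_continuous.
  exact: (smooth_continuous (smooth_derive _ (smooth_derive _ sf)) Uu).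
apply: (mixed_derivatives_commute oU Uu (D1 v) (D1 w)); by [exact: D2|exact: cD].
Qed.

Lemma local_param_sub (R : realType) (S : set 'rV[R]_3) U phi u :
  local_param S U phi -> U u -> S (phi u).
Proof.
move=> [oU _ _ _ /(_ U oU)]; case=> // O _ UO Uu.
have : (phi @` U) (phi u) by exists u.
by rewrite UO => -[].
Qed.

Section Fermi.
Context {R : realType} {S : set 'rV[R]_3} {N : 'rV[R]_3 -> 'rV[R]_3}.
Context {U : set (R * R)} {phi : R * R -> 'rV[R]_3} {u : R * R}.
Hypotheses (NS : unit_normal S N) (locU : local_param S U phi) (Uu : U u).

Let oU : open U. Proof. by case: locU. Qed.
Let sphi : smooth U phi. Proof. by case: locU. Qed.
Let sN : smooth U (N \o phi). Proof. by case: NS => _ + _; exact. Qed.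

Lemma dot_normal : dot (N (phi u)) (N (phi u)) = 1.
Proof. by case: NS => + _ _; apply; exact: local_param_sub locU Uu. Qed.

Lemma dot_partial_normal i : dot (partial2 phi i u) (N (phi u)) = 0.
Proof. by case: NS => _ _; apply; [exact: locU|]. Qed.

Lemma dot_dnormal_normal i : dot (partial2 (N \o phi) i u) (N (phi u)) = 0.
Proof.
have dN := smooth_derivable (v := e2 i) sN Uu.
have NN1 y : U y -> dot ((N \o phi) y) ((N \o phi) y) = 1.
  by move=> Uy; case: NS => + _ _; apply; exact: local_param_sub locU Uy.
have := derive_dot_cst oU Uu NN1 dN dN.
by rewrite (dotC (N _)) -mulr2n => /eqP; rewrite mulrn_eq0 => /eqP.
Qed.

Lemma dot_dnormal_partial i j :
  dot (partial2 (N \o phi) i u) (partial2 phi j u) = - sff N phi u i j.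
Proof.
have dN := smooth_derivable (v := e2 i) sN Uu.
have dphi := smooth_derivable (v := e2 i) (smooth_derive (e2 j) sphi) Uu.
have XN y : U y -> dot (partial2 phi j y) ((N \o phi) y) = 0.
  by move=> Uy; case: NS => _ _; apply; [exact: locU|].
have /eqP := derive_dot_cst oU Uu XN dphi dN.
by rewrite addrC addr_eq0 dotC !mxE => /eqP.
Qed.

Lemma sff_sym : sff N phi u 0 1 = sff N phi u 1 0.
Proof.
have E := smooth_mixed_derivatives (e2 1) (e2 0) oU sphi Uu.
by rewrite [LHS]mxE [RHS]mxE /partial2 E.
Qed.

Lemma partial3_fermi (t : R) (i : 'I_2) :
  partial3 (fermi N phi) (inord i) (u, t) =
  partial2 phi i u + t *: partial2 (N \o phi) i u.
Proof.
rewrite /partial3 /partial2.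
have -> : e3 (inord i) = (e2 i, 0) :> R * R * R.
  have i3 : (i < 3)%N by rewrite (ltn_trans (ltn_ord i)).
  rewrite /e3 ifF; first by rewrite inordK// inord_val.
  by apply/negbTE; rewrite -val_eqE /= inordK// ltn_eqF// ltnS.
by apply: derive_fermi; [exact: smooth_derivable sphi Uu|exact: smooth_derivable sN Uu].
Qed.

Lemma partial3_fermi_max (t : R) :
  partial3 (fermi N phi) ord_max (u, t) = N (phi u).
Proof. by rewrite /partial3 /e3 eqxx; exact: derive_fermi_normal. Qed.

Lemma layer_metric2E (t : R) :
  layer_metric2 N phi (u, t) =
  gram (fun i => partial2 phi i u + t *: partial2 (N \o phi) i u).
Proof. by apply/matrixP => i j; rewrite !mxE !partial3_fermi. Qed.

Lemma det_layer_metric (t : R) :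
  \det (layer_metric N phi (u, t)) = \det (layer_metric2 N phi (u, t)).
Proof.
have XN (i : 'I_2) : dot (partial3 (fermi N phi) (inord i) (u, t)) (N (phi u)) = 0.
  rewrite partial3_fermi -[partial2 phi i u]scale1r dot_lin2.
  by rewrite dot_partial_normal dot_dnormal_normal !mulr0 addr0.
have liftE (i : 'I_2) : lift ord_max i = inord i :> 'I_3.
  apply/val_inj; rewrite /= inordK; first by rewrite /bump leqNgt ltn_ord.
  by rewrite (ltn_trans (ltn_ord i)).
have wE (i : 'I_2) : widen_ord (leqnSn 2) i = inord i :> 'I_3.
  by apply/val_inj; rewrite /= inordK// (ltn_trans (ltn_ord i)).
rewrite (expand_det_row _ ord_max) big_ord_recr big1 ?add0r /=; last first.
  by move=> i _; rewrite mxE partial3_fermi_max wE dotC XN mul0r.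
rewrite mxE partial3_fermi_max dot_normal mul1r /cofactor -signr_odd /= expr0 mul1r.
rewrite add0r; congr (\det _); apply/matrixP => i j.
by rewrite 2!mxE liftE liftE [RHS]mxE.
Qed.

Lemma layer_metric_pinch (d t eps : R) :
  0 < eps < 1 -> `|t| * d <= eps / 3 -> sff_norm N phi u < d ->
  psd_le ((1 - eps) *: fff phi u) (layer_metric2 N phi (u, t)) /\
  psd_le (layer_metric2 N phi (u, t)) ((1 + eps) *: fff phi u).
Proof.
move=> eps01 td Bd; rewrite layer_metric2E.
have d0 : 0 < d by rewrite (le_lt_trans _ Bd)// sqrtr_ge0.
apply: gram_pinch eps01 td (ltW d0) _ => x y.
have rf : row_free (\matrix_i partial2 phi i u) by case: locU => _ _ _ + _; exact.
apply: (le_trans (shape_operator_le x y rf dot_normal dot_partial_normal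
  dot_dnormal_normal dot_dnormal_partial sff_sym)).
rewrite ler_wpM2r//; first by apply: sumr_ge0 => i _; exact: sqr_ge0.
set s := \tr _; have [s0|s0] := leP s 0; first by rewrite (le_trans s0)// sqr_ge0.
by rewrite -(sqr_sqrtr (ltW s0)) ler_sqr ?nnegrE ?sqrtr_ge0 ?ltW.
Qed.

Lemma sqrt_det_pinch (d t eps : R) :
  0 < eps < 1 -> `|t| * d <= eps / 3 -> sff_norm N phi u < d ->
  (1 - eps) ^+ 2 * Num.sqrt (\det (fff phi u)) <=
    Num.sqrt (\det (layer_metric N phi (u, t))) <=
  (1 + eps) ^+ 2 * Num.sqrt (\det (fff phi u)).
Proof.
move=> eps01 td Bd; have [lo up] := layer_metric_pinch eps01 td Bd.
move: eps01 => /andP[e0 e1].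
have gram_psd X (c : R) : 0 <= c -> psd (c *: gram X).
  move=> c0; apply/psd2P; rewrite !mxE; split; first by rewrite dotC.
  move=> x y; rewrite (_ : _ + _ = c * dot (x *: X 0 + y *: X 1) (x *: X 0 + y *: X 1)).
    by rewrite mulr_ge0//; apply: sumr_ge0 => i _; exact: sqr_ge0.
  by rewrite !dot3E !mxE; ring.
have detZ (c : R) : 0 <= c ->
    Num.sqrt (\det (c *: fff phi u)) = c * Num.sqrt (\det (fff phi u)).
  by move=> c0; rewrite detZ sqrtrM ?sqr_ge0// sqrtr_sqr ger0_norm.
have q0 : 0 <= Num.sqrt (\det (fff phi u)) by exact: sqrtr_ge0.
rewrite det_layer_metric; apply/andP; split.
- apply: (@le_trans _ _ ((1 - eps) * Num.sqrt (\det (fff phi u)))).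
    by rewrite ler_wpM2r//; nra.
  rewrite -detZ; last by lra.
  by apply: ler_wsqrtr; apply: det_psd2_le lo; apply: gram_psd; lra.
- apply: (@le_trans _ _ ((1 + eps) * Num.sqrt (\det (fff phi u)))); last first.
    by rewrite ler_wpM2r//; nra.
  rewrite -detZ; last by lra.
  apply: ler_wsqrtr; apply: det_psd2_le up.
  by rewrite layer_metric2E -[gram _]scale1r; exact: gram_psd.
Qed.

End Fermi.

(** * Measurability and change of variables *)

Lemma open_rational_ball (R : realType) (V : normedModType R) (I : Type) (d : I -> V)
    (U : set V) (x : V) :
  (forall y e, 0 < e -> exists i, ball (d i) e y) -> open U -> U x ->
  exists i n, ball (d i) n.+1%:R^-1 x /\ ball (d i) n.+1%:R^-1 `<=` U.
Proof.
move=> dense; rewrite openE => /[apply] /nbhs_ballP[e /= e0 eU].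
have e20 : 0 < e / 2 by rewrite divr_gt0.
have /filter_ex[n ne] := near_infty_natSinv_lt (PosNum e20).
have [i ix] := dense x n.+1%:R^-1 ltac:(by rewrite invr_gt0).
exists i, n; split=> // y iy; apply: eU; apply: (le_ball (ltW _)); last first.
  exact: ball_triangle (ball_sym ix) iy.
by rewrite [X in _ < X]splitr; exact: ltrD.
Qed.

Lemma ratr_dense (R : realType) (x e : R) : 0 < e -> exists q : rat, ball (ratr q : R) e x.
Proof.
move=> e0; have /rat_in_itvoo[q] : x - e < x + e by rewrite ltrBlDr -addrA ltrDl addr_gt0.
rewrite in_itv /= => /andP[q1 q2]; exists q.
by rewrite /ball /= ltr_norml; apply/andP; split; lra.
Qed.

Lemma rat2_dense (R : realType) (x : R * R) (e : R) :
  0 < e -> exists q : rat * rat, ball (ratr q.1 : R, ratr q.2 : R) e x.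
Proof.
move=> e0; have [q1 ?] := ratr_dense x.1 e0; have [q2 ?] := ratr_dense x.2 e0.
by exists (q1, q2).
Qed.

Lemma ratv_dense (R : realType) n (x : 'rV[R]_n) (e : R) :
  0 < e -> exists q : 'rV[rat]_n, ball (map_mx ratr q : 'rV[R]_n) e x.
Proof.
move=> e0; have /choice[q qP] i := ratr_dense (x 0 i) e0.
exists (\row_i q i); split=> // i j; rewrite !mxE ord1; exact: qP.
Qed.

Lemma open2_measurable (R : realType) (U : set (R * R)) :
  open U -> measurable (U : set (measurableTypeR R * measurableTypeR R)).
Proof.
move=> oU.
pose d (q : rat * rat) : R * R := (ratr q.1, ratr q.2).
pose B (p : rat * rat * nat) : set (measurableTypeR R * measurableTypeR R) :=
  if `[< ball (d p.1) p.2.+1%:R^-1 `<=` U >] then ball (d p.1) p.2.+1%:R^-1 else set0.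
have -> : U = \bigcup_p B p.
  apply/seteqP; split=> [x Ux|x [p _]]; rewrite /B.
    have [i [n [ix iU]]] := open_rational_ball (@rat2_dense R) oU Ux.
    by exists (i, n) => //=; rewrite asboolT.
  by case: asboolP => // pU px; exact: pU.
apply: countable_bigcupT_measurable => [|p]; first exact: countableP.
rewrite /B; case: asboolP => // _.
have -> : ball (d p.1) p.2.+1%:R^-1 =
    ball (ratr p.1.1 : R) p.2.+1%:R^-1 `*` ball (ratr p.1.2 : R) p.2.+1%:R^-1.
  by apply/seteqP; split.
by apply: measurableX; apply: open_measurable; exact: ball_open.
Qed.

Lemma open_preimageI (V W : topologicalType) (U : set V) (f : V -> W) (O : set W) :
  open U -> (forall x, U x -> {for x, continuous f}) -> open O -> open (U `&` f @^-1` O).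
Proof.
move=> oU cf oO; rewrite openE => x [Ux Ofx].
apply: filterI; first exact: open_nbhs_nbhs.
by apply: cf => //; exact: open_nbhs_nbhs.
Qed.

Section OpenDomain.
Context {R : realType} {U : set (R * R)}.
Hypothesis oU : open U.
Local Notation mR := (measurableTypeR R).

Lemma continuous_measurable2 (f : R * R -> R) :
  (forall x, U x -> {for x, continuous f}) ->
  measurable_fun (U : set (mR * mR)) (f : mR * mR -> mR).
Proof.
move=> cf; apply: (measurability _ (RGenOpens.measurableE R)).
move=> _ [_ [a [b ->] <-]]; apply: open2_measurable.
by apply: open_preimageI => //; exact: interval_open.
Qed.

Lemma continuous_measurable_borel3 (f : R * R -> 'rV[R]_3) :
  (forall x, U x -> {for x, continuous f}) ->
  measurable_fun (U : set (mR * mR)) (f : mR * mR -> borel3 R).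
Proof.
move=> cf; apply: (@measurability _ _ _ (borel3 R) _ _ open erefl).
move=> _ [B oB <-]; apply: open2_measurable.
exact: open_preimageI.
Qed.

End OpenDomain.

Section DensityChangeOfVariables.
Import HBNNSimple.
Local Open Scope ereal_scope.
Context d d' (T : measurableType d) (Y : measurableType d') (R : realType).
Variables (m : {measure set T -> \bar R}) (mu : {measure set Y -> \bar R}).
Variables (U : set T) (phi : T -> Y) (J : T -> R) (Z : set Y).
Hypotheses (mU : measurable U) (mphi : measurable_fun setT phi).
Hypotheses (mJ : measurable_fun U J) (J0 : forall u, (0 <= J u)%R).
Hypothesis muE : forall A, measurable A -> A `<=` Z ->
  mu A = \int[m]_(u in U `&` phi @^-1` A) (J u)%:E.

Lemma ge0_integral_density (f : Y -> \bar R) :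
  measurable_fun setT f -> (forall y, 0 <= f y) -> (forall y, f y != 0 -> Z y) ->
  \int[mu]_y f y = \int[m]_(u in U) (f (phi u) * (J u)%:E).
Proof.
move=> mf f0 fZ; pose g := nnsfun_approx measurableT mf.
have gf n y : (g n y)%:E <= f y by rewrite /g nnsfun_approxE; exact: le_approx.
have gcvg y : (g n y)%:E @[n --> \oo] --> f y by exact: cvg_nnsfun_approx.
have gnd y : {homo (fun n => (g n y)%:E) : a b / (a <= b)%N >-> a <= b}.
  by move=> a b ab; rewrite lee_fin; exact/lefP/nd_nnsfun_approx.
have mJE : measurable_fun U (EFin \o J) by exact/measurable_EFinP.
have mgphi n : measurable_fun U (fun u => (g n (phi u))%:E).
  apply/measurable_EFinP; apply: measurable_funTS.
  exact: (measurableT_comp (measurable_funP (g n)) mphi).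
transitivity (limn (fun n => \int[mu]_y (g n y)%:E)).
  rewrite -monotone_convergence//.
  - by apply: eq_integral => y _; apply/esym/cvg_lim => //; exact: gcvg.
  - by move=> n; exact/measurable_EFinP/measurable_funP.
  - by move=> n y _; rewrite lee_fin.
transitivity (limn (fun n => \int[m]_(u in U) ((g n (phi u))%:E * (J u)%:E))); last first.
  rewrite -monotone_convergence//.
  - apply: eq_integral => u _; apply/cvg_lim => //.
    by apply: cvgeZr => //; exact: gcvg.
  - by move=> n; exact: emeasurable_funM.
  - by move=> n u _; rewrite mule_ge0// lee_fin.
  - by move=> u _ a b ab; rewrite lee_wpmul2r ?lee_fin//; exact/lefP/nd_nnsfun_approx.
congr (limn _); apply/funext => n.
rewrite integral_nnsfun// sintegralE patch_setT.
have mpre k : measurable (g n @^-1` [set k]) by exact: measurable_sfunP.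
have mpreU k : measurable (U `&` phi @^-1` (g n @^-1` [set k])).
  by apply: measurableI => //; rewrite -[X in measurable X]setTI; exact: mphi.
transitivity (\sum_(k \in range (g n))
    \int[m]_(u in U) (k%:E * ((\1_(g n @^-1` [set k]) (phi u))%:E * (J u)%:E))).
  apply: eq_fsbigr => k; rewrite inE => -[y _ <-{k}].
  rewrite ge0_integralZl_EFin//; last 2 first.
  - by move=> u _; rewrite mule_ge0 ?lee_fin.
  - apply: emeasurable_funM => //; apply/measurable_EFinP/measurable_funTS.
    exact: (measurableT_comp _ mphi).
  have [->|gy0] := eqVneq (g n y) 0%R; first by rewrite !mul0e.
  congr (_ * _); rewrite muE//; last first.
    move=> z /= gz; apply: fZ; rewrite gt_eqF// (lt_le_trans _ (gf n z))//.
    by rewrite lte_fin gz lt_neqAle eq_sym gy0 /=.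
  rewrite integral_mkcondr; apply: eq_integral => u _.
  rewrite patchE indicE.
  have -> : (phi u \in g n @^-1` [set g n y]) = (u \in phi @^-1` (g n @^-1` [set g n y])).
    by apply/idP/idP; rewrite !inE.
  by case: ifPn; rewrite ?mul1e ?mul0e.
rewrite -ge0_integral_fsum//; last 2 first.
- move=> k; apply/measurable_funeM; apply: emeasurable_funM => //.
  by apply/measurable_EFinP/measurable_funTS; exact: (measurableT_comp _ mphi).
- move=> k u _; rewrite muleA mule_ge0 ?lee_fin//.
  exact: nnfun_muleindic_ge0.
apply: eq_integral => u _; rewrite fimfunE -fsumEFin//.
rewrite ge0_mule_fsuml; last by move=> k; rewrite EFinM; exact: nnfun_muleindic_ge0.
by apply: eq_fsbigr => k _; rewrite EFinM muleA.
Qed.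

End DensityChangeOfVariables.

Section WithSigmaFinite.
Context d (T : measurableType d) (R : realType) (m : {measure set T -> \bar R}).

(* The sigma-finite instance of the library for product measures is shadowed by the
   instance for products of subprobabilities, so that [leb2] has no canonical
   sigma-finite structure. *)
Definition with_sigma_finite (sfm : sigma_finite setT m) : set T -> \bar R := m.

Variable sfm : sigma_finite setT m.

HB.instance Definition _ := Measure.on (with_sigma_finite sfm).
HB.instance Definition _ :=
  Measure_isSigmaFinite.Build _ _ _ (with_sigma_finite sfm) sfm.

End WithSigmaFinite.

Section ProductDensity.
Local Open Scope ereal_scope.
Context d d' d'' (T : measurableType d) (Y : measurableType d') (X : measurableType d'').
Context (R : realType).
Variables (m : {measure set T -> \bar R}) (sfm : sigma_finite setT m).
Variables (l : {sigma_finite_measure set X -> \bar R}) (mu : {measure set Y -> \bar R}).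
Variables (U : set T) (phi : T -> Y) (J : T -> R) (Z : set Y).
Hypotheses (mU : measurable U) (mphi : measurable_fun setT phi).
Hypotheses (mJ : measurable_fun U J) (J0 : forall u, (0 <= J u)%R).
Hypothesis muE : forall A, measurable A -> A `<=` Z ->
  mu A = \int[m]_(u in U `&` phi @^-1` A) (J u)%:E.
Variable B : set (Y * X).
Hypotheses (mB : measurable B) (BZ : forall q, B q -> Z q.1).

Let Q := [set q : T * X | U q.1 /\ B (phi q.1, q.2)].

Lemma measurable_chart_preimage : measurable Q.
Proof.
have -> : Q = (U `*` setT) `&` (fun q => (phi q.1, q.2)) @^-1` B.
  by apply/seteqP; split=> [q [? ?]|q [[? _] ?]].
apply: measurableI; first exact: measurableX.
rewrite -[X in measurable X]setTI.
suff : measurable_fun setT (fun q : T * X => (phi q.1, q.2)) by exact.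
apply: measurable_fun_pair; last exact: measurable_snd.
exact: (measurableT_comp mphi measurable_fst).
Qed.

Lemma product_measure_density :
  (mu \x l) B = \int[m \x l]_(q in Q) (J q.1)%:E.
Proof.
have mQ := measurable_chart_preimage.
transitivity (\int[mu]_y (l \o xsection B) y); first by [].
rewrite (ge0_integral_density mU mphi mJ J0 muE); last 3 first.
- exact: measurable_fun_xsection.
- by move=> y; exact: measure_ge0.
- move=> y; apply: contra_neqP => nZy.
  rewrite /= (_ : xsection B y = set0) ?measure0//.
  by apply/seteqP; split=> // x /xsectionP /BZ.
have mJQ : measurable_fun Q (fun q => J q.1).
  apply: (measurable_comp mU _ mJ); first by move=> _ [q [Uq _] <-].
  exact: measurable_funS measurable_fst.
rewrite [RHS]integral_mkcond.
rewrite (@fubini_tonelli1 _ _ _ _ _ (with_sigma_finite sfm) l); last 2 first.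
- apply/(measurable_restrictT _ mQ); exact/measurable_EFinP.
- by move=> q; apply: erestrict_ge0 => p _; rewrite lee_fin.
rewrite [LHS]integral_mkcond; apply: eq_integral => u _.
rewrite patchE /fubini_F; case: ifPn => Uu; last first.
  rewrite integral0_eq// => x _; rewrite patchE ifF//.
  by apply/negbTE; rewrite notin_setE => -[/= /mem_set]; rewrite (negbTE Uu).
rewrite muleC -integral_cst; last exact: measurable_xsection.
rewrite integral_mkcond; apply: eq_integral => x _; rewrite !patchE.
have -> // : (x \in xsection B (phi u)) = ((u, x) \in Q).
rewrite mem_xsection; apply/idP/idP; rewrite !inE; last by case.
by split=> //; exact: set_mem.
Qed.

End ProductDensity.

Lemma measurable_sqrt_det_gram (R : realType) d (T : measurableType d) (D : set T)
    (X : T -> 'I_2 -> 'rV[R]_3) :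
  (forall i k, measurable_fun D (fun x => X x i 0 k)) ->
  measurable_fun D (fun x => Num.sqrt (\det (gram (X x)))).
Proof.
move=> mX; apply: measurableT_comp.
  by apply: continuous_measurable_fun; exact: sqrt_continuous.
have mdot i j : measurable_fun D (fun x => dot (X x i) (X x j)).
  by apply: measurable_sum => k; exact: measurable_funM.
have -> : (fun x => \det (gram (X x))) = (fun x =>
    dot (X x 0) (X x 0) * dot (X x 1) (X x 1) - dot (X x 0) (X x 1) * dot (X x 1) (X x 0)).
  by apply/funext => x; rewrite det2E !mxE.
by apply: measurable_funB; exact: measurable_funM.
Qed.

Lemma local_param_measurable (R : realType) (S : set 'rV[R]_3) U phi :
  local_param S U phi -> exists phi0 : measurableTypeR R * measurableTypeR R -> borel3 R,
    measurable_fun setT phi0 /\ forall u, U u -> phi0 u = phi u.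
Proof.
case=> oU sphi _ _ _; exists (fun u => if u \in U then phi u else 0); split; last first.
  by move=> u Uu; rewrite mem_set.
have mU := open2_measurable oU.
have fU : (fun u => u \in U) @^-1` [set true] = U.
  by apply/seteqP; split=> u; [exact: set_mem|exact: mem_set].
apply: measurable_fun_if => //.
- by apply: (measurable_fun_bool true); rewrite setTI fU.
- rewrite setTI fU; apply: continuous_measurable_borel3 => // u Uu.
  exact: (smooth_continuous sphi Uu).
Qed.

Lemma sigma_finite_leb2 (R : realType) : sigma_finite setT (leb2 R).
Proof.
have /sigma_finiteP[F [TF ndF Foo]] := sigma_finiteT (@lebesgue_measure R).
exists (fun n => F n `*` F n).
  apply/seteqP; split=> // -[x y] _.
  have : setT x by []; have : setT y by []; rewrite TF => -[n _ Fy] [k _ Fx].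
  exists (maxn n k) => //; split.
  - by move: x Fx; exact/subsetPset/ndF/leq_maxr.
  - by move: y Fy; exact/subsetPset/ndF/leq_maxl.
move=> n; have [mF Fn] := Foo n; split; first exact: measurableX.
by rewrite [leb2 R _]product_measure1E// lte_mul_pinfty// ge0_fin_numE.
Qed.

(** * Comparison of the measures *)

Section ChartComparison.
Context {R : realType} {S : set 'rV[R]_3} {N : 'rV[R]_3 -> 'rV[R]_3} {a : R}.
Context {U : set (R * R)} {phi : R * R -> 'rV[R]_3}.
Hypotheses (NS : unit_normal S N) (locU : local_param S U phi).
Local Notation mR := (measurableTypeR R).

Lemma measurable_partial2 (f : R * R -> 'rV[R]_3) (i : 'I_2) (k : 'I_3) :
  smooth U f ->
  measurable_fun (U : set (mR * mR)) (fun u : mR * mR => partial2 f i u 0 k).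
Proof.
move=> sf; have [oU _ _ _ _] := locU; apply: (continuous_measurable2 oU) => u Uu.
apply: (@continuous_comp _ _ _ (partial2 f i) (fun M : 'rV[R]_3 => M 0 k));
  last exact: coord_continuous.
exact: (smooth_continuous (smooth_derive (e2 i) sf) Uu).
Qed.

Lemma measurable_sqrt_det_layer (Q : set (mR * mR * mR)) :
  measurable Q -> (forall q, Q q -> U q.1) ->
  measurable_fun Q (fun q => Num.sqrt (\det (layer_metric N phi q))).
Proof.
move=> mQ QU; have [oU sphi _ _ _] := locU.
have sN : smooth U (N \o phi) by case: NS => _ + _; exact.
pose X (q : mR * mR * mR) i := partial2 phi i q.1 + q.2 *: partial2 (N \o phi) i q.1.
apply: (eq_measurable_fun (fun q => Num.sqrt (\det (gram (X q))))).
  move=> [u t]; rewrite inE => /QU/= Uu.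
  by rewrite (det_layer_metric NS locU Uu) (layer_metric2E NS locU Uu).
have mQ1 (f : mR * mR -> R) : measurable_fun (U : set (mR * mR)) f ->
    measurable_fun Q (fun q => f q.1).
  move=> mf; apply: (measurable_comp (open2_measurable oU) _ mf).
    by move=> _ [q Qq <-]; exact: QU.
  exact: measurable_funS measurable_fst.
apply: measurable_sqrt_det_gram => i k.
rewrite (_ : (fun q => _) = (fun q : mR * mR * mR => partial2 phi i q.1 0 k
    + q.2 * partial2 (N \o phi) i q.1 0 k)); last by apply/funext => q; rewrite !mxE.
apply: measurable_funD; first exact: mQ1 (measurable_partial2 i k sphi).
apply: measurable_funM; last exact: mQ1 (measurable_partial2 i k sN).
exact: measurable_funS measurable_snd.
Qed.

Lemma chart_comparison (dSigma : {measure set (borel3 R) -> \bar R})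
    (dOmega : {measure set (borel3 R * mR) -> \bar R}) (c1 c2 : R)
    (B : set (borel3 R * mR)) :
  surface_measure S dSigma -> layer_measure S N a dOmega -> 0 <= c1 -> 0 <= c2 ->
  measurable B -> B `<=` (phi @` U) `*` `[- a, a] ->
  (forall u t, U u -> B (phi u, t) ->
     c1 * Num.sqrt (\det (fff phi u)) <= Num.sqrt (\det (layer_metric N phi (u, t)))
       <= c2 * Num.sqrt (\det (fff phi u))) ->
  (c1%:E * (dSigma \x @lebesgue_measure R) B <= dOmega B)%E /\
  (dOmega B <= c2%:E * (dSigma \x @lebesgue_measure R) B)%E.
Proof.
move=> [_ dSE] [_ dOE] c10 c20 mB BU H.
have [oU sphi _ _ _] := locU; have mU := open2_measurable oU.
have [phi0 [mphi0 phiE]] := local_param_measurable locU.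
pose J (u : mR * mR) := Num.sqrt (\det (fff phi u)).
have J0 u : 0 <= J u by exact: sqrtr_ge0.
have mJ : measurable_fun (U : set (mR * mR)) J.
  apply: (measurable_sqrt_det_gram (X := fun u i => partial2 phi i u)) => i k.
  exact: measurable_partial2.
have UE A : U `&` phi @^-1` A = (U : set (mR * mR)) `&` phi0 @^-1` A.
  by apply/seteqP; split=> u [Uu] /=; rewrite phiE.
have dS (A : set (borel3 R)) : measurable A -> A `<=` phi @` U ->
    dSigma A = (\int[leb2 R]_(u in (U : set (mR * mR)) `&` phi0 @^-1` A) (J u)%:E)%E.
  by move=> mA AU; rewrite (dSE U phi)// UE.
have BZ q : B q -> (phi @` U) q.1 by move=> /BU[].
have mQ := measurable_chart_preimage mU mphi0 mB.
have prodE := @product_measure_density _ _ _ _ _ _ _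
  (leb2 R) (sigma_finite_leb2 R) (@lebesgue_measure R) dSigma
  U phi0 J (phi @` U) mU mphi0 mJ J0 dS B mB BZ.
have QE : [set q : R * R * R | U q.1 /\ B (phi q.1, q.2)] =
    [set q : mR * mR * mR | U q.1 /\ B (phi0 q.1, q.2)].
  by apply/seteqP; split=> q /= [Uq]; rewrite phiE.
rewrite (dOE U phi)// QE {}prodE -/(leb2 R) -/(leb3 R).
set Q := [set q | _] in mQ *.
have mJQ : measurable_fun Q (fun q => J q.1).
  apply: (measurable_comp mU _ mJ); first by move=> _ [q [Uq _] <-].
  exact: measurable_funS measurable_fst.
have mK := measurable_sqrt_det_layer mQ (fun q Qq => Qq.1).
have HQ q : Q q -> c1 * J q.1 <= Num.sqrt (\det (layer_metric N phi q)) <= c2 * J q.1.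
  by case: q => u t [/= Uu]; rewrite phiE//; exact: H.
split; rewrite -ge0_integralZl_EFin//.
- apply: ge0_le_integral => //.
  + by move=> q _; rewrite mule_ge0// lee_fin.
  + by apply: measurable_funeM; exact/measurable_EFinP.
  + exact/measurable_EFinP.
  + by move=> q /HQ/andP[+ _]; rewrite -EFinM lee_fin.
- by move=> q _; rewrite lee_fin.
- exact/measurable_EFinP.
- apply: ge0_le_integral => //.
  + exact/measurable_EFinP.
  + by apply: measurable_funeM; exact/measurable_EFinP.
  + by move=> q /HQ/andP[_]; rewrite -EFinM lee_fin.
- by move=> q _; rewrite lee_fin.
- exact/measurable_EFinP.
Qed.

End ChartComparison.

Lemma countable_charts (R : realType) (S : set 'rV[R]_3) :
  embedded_surface S ->
  exists B : nat -> set 'rV[R]_3,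
    [/\ forall n, open (B n), S `<=` \bigcup_n B n &
        forall n, B n = set0 \/
          exists U phi, local_param S U phi /\ S `&` B n `<=` phi @` U].
Proof.
move=> embS; pose V (p : 'rV[rat]_3 * nat) : set 'rV[R]_3 :=
  ball (map_mx ratr p.1 : 'rV[R]_3) p.2.+1%:R^-1.
pose chart p := exists U phi, local_param S U phi /\ S `&` V p `<=` phi @` U.
exists (fun n => if unpickle n is Some p then
                   if `[< chart p >] then V p else set0 else set0); split.
- move=> n; case: (unpickle n) => [p|]; last exact: open0.
  by case: ifP => _; [exact: ball_open|exact: open0].
- move=> x Sx; have [U [phi [locU phix]]] := embS x Sx.
  have [oU _ _ _ /(_ U oU)] := locU; case=> // W oW UW.
  have Wx : W x by move: phix; rewrite UW => -[].
  have [i [n [ix iW]]] := open_rational_ball (@ratv_dense R 3) oW Wx.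
  exists (pickle (i, n)) => //=; rewrite pickleK asboolT//.
  by exists U, phi; split=> // y [Sy Vy]; rewrite UW; split=> //; exact: iW.
- move=> n; case: (unpickle n) => [p|]; last by left.
  by case: asboolP => ?; [right|left].
Qed.

Theorem proposition2p2 (R : realType) (S : set 'rV[R]_3)
    (N : 'rV[R]_3 -> 'rV[R]_3) (a : R) :
  embedded_surface S ->
  orientable S ->
  complete_surface S ->
  ~ compact S ->
  unit_normal S N ->
  ~ totally_geodesic S N ->
  sff_vanishes_at_infinity S N ->
  0 < a ->
  layer_embedding S N a ->
  forall eps : R, 0 < eps < 1 ->
  exists K : set 'rV[R]_3,
    [/\ compact K,
        K `<=` S,
        (forall (U : set (R * R)) (phi : R * R -> 'rV[R]_3) (u : R * R) (t : R),
           local_param S U phi -> U u -> ~ K (phi u) -> - a <= t <= a ->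
           psd_le ((1 - eps) *: fff phi u) (layer_metric2 N phi (u, t)) /\
           psd_le (layer_metric2 N phi (u, t)) ((1 + eps) *: fff phi u)) &
        (forall (dSigma : {measure set (borel3 R) -> \bar R})
                (dOmega : {measure set (borel3 R * measurableTypeR R) -> \bar R}),
           surface_measure S dSigma -> layer_measure S N a dOmega ->
           forall A : set (borel3 R * measurableTypeR R),
             measurable A -> A `<=` layer (S `\` K) a ->
             (((1 - eps) ^+ 2)%:E * (dSigma \x @lebesgue_measure R) A <= dOmega A)%E /\
             (dOmega A <= ((1 + eps) ^+ 2)%:E * (dSigma \x @lebesgue_measure R) A)%E)].
Proof.
move=> embS _ _ _ NS _ sffS a0 _ eps eps01.
have /andP[e0 e1] := eps01.
pose d := eps / 3 / a.
have d0 : 0 < d by rewrite !divr_gt0.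
have td t : - a <= t <= a -> `|t| * d <= eps / 3.
  rewrite -ler_norml => ta; rewrite /d mulrA ler_pdivrMr// mulrC.
  by rewrite ler_wpM2l// divr_ge0// ltW.
have [K [cK KS sffK]] := sffS d d0.
exists K; split=> // [U phi u t locU Uu nK /td tda|dSigma dOmega dS dO A mA AK].
  exact: (layer_metric_pinch NS locU Uu eps01 tda (sffK _ _ _ locU Uu nK)).
have [V [oV SV chartV]] := countable_charts embS.
pose B n : set (borel3 R * measurableTypeR R) := A `&` (seqDU V n `*` setT).
have mV n : measurable (V n : set (borel3 R)) by exact: sub_sigma_algebra.
have mB n : measurable (B n).
  apply: measurableI => //; apply: measurableX => //.
  by apply: measurableD => //; exact: bigsetU_measurable.
have AB : A = \bigcup_n B n.
  rewrite -setI_bigcupr -setX_bigcupl -seqDU_bigcup_eq.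
  apply/seteqP; split=> [q Aq|q []//]; split=> //; split=> //.
  by apply: SV; case: (AK q Aq) => -[].
have tB : trivIset setT B.
  apply/trivIsetP => i j _ _ ij; apply/seteqP; split=> // q [[_ [qi _]] [_ [qj _]]].
  have /trivIsetP/(_ i j I I ij) := trivIset_seqDU V.
  by rewrite -subset0; apply; split; [exact: qi|exact: qj].
have cmp n :
   ((((1 - eps) ^+ 2)%:E * (dSigma \x @lebesgue_measure R) (B n) <= dOmega (B n)) /\
    (dOmega (B n) <= ((1 + eps) ^+ 2)%:E * (dSigma \x @lebesgue_measure R) (B n)))%E.
  have [Vn0|[U [phi [locU SU]]]] := chartV n.
    have -> : B n = set0.
      by apply/seteqP; split=> // q [_ [[+ _] _]]; rewrite Vn0.
    by rewrite !measure0 !mule0.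
  apply: (chart_comparison NS locU dS dO) => //; rewrite ?sqr_ge0//.
    move=> q [Aq [[Vq _] _]]; have [[Sq _] aq] := AK q Aq.
    by split=> //; exact: SU.
  move=> u t Uu [Aq _]; have [[_ nK] /=] := AK _ Aq; rewrite in_itv /= => ta.
  exact: (sqrt_det_pinch NS locU Uu eps01 (td t ta) (sffK _ _ _ locU Uu nK)).
rewrite [in X in X /\ _]AB [in X in _ /\ X]AB.
rewrite (measure_bigcup dOmega)//.
rewrite (measure_bigcup (dSigma \x @lebesgue_measure R)%E)//.
rewrite -!nneseriesZl//.
split; apply: lee_nneseries => // n _; rewrite ?mule_ge0 ?lee_fin ?sqr_ge0//;
  by have [] := cmp n.
Qed.
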